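(* Let $n \ge 2$, let $K$ be a (non-archimedean) local field, and let $Y_n$ be the graph of special vertices of the affine building $\Delta_n$ of $\mathrm{Sp}_n(K)$. Then there is a constant $C>1$ such that for every vertex $x$ of $Y_n$ and every integer $i\ge 1$, $\mathrm{Card}(B_i(x))>C^i$.
   Context: $K$ is a local field with discrete valuation $\mathrm{ord}$, valuation ring $\mathcal{O}$, uniformizer $\pi$, residue field $k\cong\mathbb{F}_q$. $V$ is a $2n$-dimensional $K$-vector space with a non-degenerate alternating bilinear form $\langle\cdot,\cdot\rangle$. A lattice in $V$ is a free rank-$2n$ $\mathcal{O}$-submodule of $V$; lattices $L,L'$ are homothetic if $L'=\alpha L$ for some $\alpha\in K^\times$, and $[L]$ is the homothety class of $L$. A lattice $L$ is primitive if $\langle L,L\rangle\subseteq\mathcal{O}$ and $\langle\cdot,\cdot\rangle$ induces a non-degenerate alternating $k$-bilinear form on $L/\pi L$. The building $\Delta_n$: a vertex of $\Delta_n$ is a homothety class of lattices having a representative $L$ for which there is a primitive lattice $L_0$ with $\langle L,L\rangle\subseteq\pi\mathcal{O}$ and $\pi L_0\subseteq L\subseteq L_0$. Two vertices $t,t'$ are incident if there are representatives $L\in t$, $L'\in t'$ and a primitive lattice $L_0$ with $\langle L,L\rangle\subseteq\pi\mathcal{O}$, $\langle L',L'\rangle\subseteq\pi\mathcal{O}$, and either $\pi L_0\subseteq L\subseteq L'\subseteq L_0$ or $\pi L_0\subseteq L'\subseteq L\subseteq L_0$. Two distinct incident vertices are called adjacent. A basis $\{u_1,\dots,u_n,w_1,\dots,w_n\}$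 of $V$ is symplectic if $\langle u_i,w_j\rangle=\delta_{ij}$ and $\langle u_i,u_j\rangle=0=\langle w_i,w_j\rangle$ for all $i,j$. A vertex $[L]$ of $\Delta_n$ is special if, writing $L=\sum_i\mathcal{O}\pi^{a_i}u_i+\sum_i\mathcal{O}\pi^{b_i}w_i$ in a symplectic basis (with $a_i,b_i\in\mathbb{Z}$), the sum $a_i+b_i$ is the same for all $i$ (this does not depend on the choices). $Y_n$ is the graph whose vertices are the special vertices of $\Delta_n$, two of them being joined by an edge iff they are adjacent in $\Delta_n$. For a vertex $x$ of $Y_n$, $B_i(x)=\{y\in Y_n: d(x,y)\le i\}$, where $d$ is the graph distance in $Y_n$. *)

(* Defs.v *)
From HB Require Import structures.
From mathcomp Require Import all_boot all_order all_algebra.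
From mathcomp Require Import sesquilinear.
From mathcomp Require Import boolp classical_sets functions cardinality reals.
From mathcomp Require Import ereal counting_measure.

Set Implicit Arguments.
Unset Strict Implicit.
Unset Printing Implicit Defensive.

Import Order.TTheory GRing.Theory Num.Theory.

Local Open Scope classical_set_scope.
Local Open Scope ring_scope.

Section LocalField.
Variables (K : fieldType) (ord : K -> int).

(* [ord 0] is an unconstrained junk value standing for +oo; every use of [ord]
   below treats 0 separately. *)
Definition ord_ge (m : int) : set K := [set x | x = 0 \/ m <= ord x].

Definition valring : set K := ord_ge 0.

Definition residue_classes : set (set K) :=
  [set [set y | ord_ge 1 (y - x)] | x in valring].

Definition ord_cauchy (s : nat -> K) : Prop :=
  forall N : int, exists M : nat, forall i j : nat,
    (M <= i)%N -> (M <= j)%N -> ord_ge N (s i - s j).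

Definition ord_cvg (s : nat -> K) (l : K) : Prop :=
  forall N : int, exists M : nat, forall i : nat,
    (M <= i)%N -> ord_ge N (s i - l).

Definition uniformizer (pi : K) : Prop := pi != 0 /\ ord pi = 1.

(* Non-archimedean local field: complete for a normalized discrete valuation,
   with finite residue field. *)
Record local_field : Prop := LocalField {
  lf_ordM : forall x y, x != 0 -> y != 0 -> ord (x * y) = ord x + ord y;
  lf_ordD : forall x y, x != 0 -> y != 0 -> x + y != 0 ->
    Num.min (ord x) (ord y) <= ord (x + y);
  lf_uniformizer : exists pi, uniformizer pi;
  lf_complete : forall s, ord_cauchy s -> exists l, ord_cvg s l;
  lf_residue_finite : finite_set residue_classes
}.

End LocalField.

Section Form.
Variables (K : fieldType) (V : vectType K) (B : {biscalar V}).

Definition alternating_form : Prop := forall v, B v v = 0.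

Definition nondegenerate_form : Prop :=
  forall v, (forall w, B v w = 0) -> v = 0.

Definition symplectic_basis (n : nat) (u w : n.-tuple V) : Prop :=
  [/\ basis_of fullv (u ++ w),
      forall i j, B (tnth u i) (tnth w j) = (i == j)%:R,
      forall i j, B (tnth u i) (tnth u j) = 0
    & forall i j, B (tnth w i) (tnth w j) = 0].

End Form.

Section Building.
Variables (n : nat) (K : fieldType) (ord : K -> int) (pi : K).
Variables (V : vectType K) (B : {biscalar V}).

Local Notation O := (valring ord).

Definition lattice (L : set V) : Prop :=
  exists e : 'I_(2 * n) -> V,
    (forall c : 'I_(2 * n) -> K, (forall i, O (c i)) ->
       \sum_i c i *: e i = 0 -> forall i, c i = 0) /\
    L = [set v | exists c : 'I_(2 * n) -> K,
           (forall i, O (c i)) /\ v = \sum_i c i *: e i].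

Definition dilate (a : K) (L : set V) : set V := [set a *: v | v in L].

Definition homothety_class (L : set V) : set (set V) :=
  [set dilate a L | a in [set a : K | a != 0]].

Definition pi_valring : set K := [set pi * a | a in O].

Definition form_in (I : set K) (L : set V) : Prop :=
  forall v w, L v -> L w -> I (B v w).

(* The last clause is the triviality of the radical of the k-bilinear form
   induced by B on L / pi L; that this form is alternating is automatic. *)
Definition primitive (L : set V) : Prop :=
  [/\ lattice L,
      form_in O L
    & forall v, L v -> (forall w, L w -> pi_valring (B v w)) ->
        dilate pi L v].

Definition vertex (t : set (set V)) : Prop :=
  (exists2 L, lattice L & t = homothety_class L) /\
  exists L L0 : set V,
    [/\ t L, primitive L0, form_in pi_valring L, dilate pi L0 `<=` L
      & L `<=` L0].

Definition incident (t t' : set (set V)) : Prop :=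
  exists L L' L0 : set V,
    [/\ t L /\ t' L', primitive L0, form_in pi_valring L,
        form_in pi_valring L'
      & [/\ dilate pi L0 `<=` L, L `<=` L' & L' `<=` L0] \/
        [/\ dilate pi L0 `<=` L', L' `<=` L & L `<=` L0]].

Definition adjacent (t t' : set (set V)) : Prop := t <> t' /\ incident t t'.

(* sum_i O pi^(a_i) u_i + sum_i O pi^(b_i) w_i *)
Definition frame_lattice (u w : n.-tuple V) (a b : 'I_n -> int) : set V :=
  [set v | exists c d : 'I_n -> K,
     [/\ forall i, O (c i), forall i, O (d i)
       & v = \sum_i (c i * pi ^ a i) *: tnth u i
             + \sum_i (d i * pi ^ b i) *: tnth w i]].

Definition special_vertex (t : set (set V)) : Prop :=
  vertex t /\
  exists L (u w : n.-tuple V) (a b : 'I_n -> int),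
    [/\ t L, symplectic_basis B u w, L = frame_lattice u w a b
      & forall i j, a i + b i = a j + b j].

Definition Y_edge (t t' : set (set V)) : Prop :=
  [/\ special_vertex t, special_vertex t' & adjacent t t'].

End Building.

Section Graph.
Variables (T : Type) (e : T -> T -> Prop).

Definition walk (k : nat) (x y : T) : Prop :=
  exists p : nat -> T,
    [/\ p 0%N = x, p k = y & forall j, (j < k)%N -> e (p j) (p j.+1)].

(* +oo when y cannot be reached from x *)
Definition graph_dist (R : realType) (x y : T) : \bar R :=
  ereal_inf [set k%:R%:E | k in [set k | walk k x y]].

End Graph.

Definition Y_ball (R : realType) (n : nat) (K : fieldType) (ord : K -> int)
    (pi : K) (V : vectType K) (B : {biscalar V}) (i : nat)
    (x : set (set V)) : set (set (set V)) :=
  [set y | special_vertex n ord pi B y /\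
           (graph_dist (Y_edge n ord pi B) R x y <= i%:R%:E)%E].

(* Main.v *)
Require Import Defs.
From mathcomp Require Import all_boot all_order all_algebra.
From mathcomp Require Import sesquilinear.
From mathcomp Require Import boolp classical_sets functions cardinality reals.
From mathcomp Require Import ereal counting_measure.
From mathcomp Require Import zify ring lra.

Set Implicit Arguments.
Unset Strict Implicit.
Unset Printing Implicit Defensive.

Import Order.TTheory GRing.Theory Num.Theory.

Local Open Scope classical_set_scope.
Local Open Scope ring_scope.

(** The balls grow exponentially because every special vertex is the root of a
binary tree embedded in the graph: the tree of SL_2, placed diagonally in the n
hyperbolic planes of a symplectic basis and cut down to two branches at each
step.

In a symplectic basis (u, w), a special vertex can be written as the class of
the lattice sum_i O u_i + sum_i O pi^m w_i ([special_vertexE]), and replacing m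
by m + 1 gives an adjacent special vertex ([balanced_Y_edge]). Increasing m
thus draws a ray from x in the graph. Now replace u_i by u_i + p w_i with p in
pi^m O. The new basis is again symplectic and has the same lattice at level m
([balanced_transvection]), so that it draws another ray from the same vertex x;
but the vertex at distance i on this ray determines p modulo pi^(m + i)
([transvection_class_inj]). Letting p run through the pi^m (b_0 + b_1 pi + ... +
b_(i-1) pi^(i-1)) with digits b_k in {0, 1}, which are pairwise incongruent
modulo pi^(m + i) ([pi_adic_inj]), produces 2^i distinct vertices of B_i(x),
more than (3/2)^i. *)

(** * Valuations and digit expansions *)

Section Valuation.
Variables (K : fieldType) (ord : K -> int) (hK : local_field ord).

Lemma ord1 : ord 1 = 0.
Proof.
have /eqP := lf_ordM hK (oner_neq0 K) (oner_neq0 K).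
by rewrite mulr1 -subr_eq0 opprD addNKr oppr_eq0 => /eqP.
Qed.

Lemma ordN1 : ord (- 1) = 0.
Proof.
have h : (-1 : K) != 0 by rewrite oppr_eq0 oner_neq0.
have := lf_ordM hK h h.
by rewrite mulrNN mulr1 ord1; lia.
Qed.

Lemma ord_ge0 m : ord_ge ord m 0.
Proof. by left. Qed.

Lemma ord_geW m k x : k <= m -> ord_ge ord m x -> ord_ge ord k x.
Proof. by move=> km [->|h]; [left|right; exact: le_trans h]. Qed.

Lemma ord_geE m x : x != 0 -> ord_ge ord m x <-> m <= ord x.
Proof. by move=> x0; split => [[x00|]//|]; [rewrite x00 eqxx in x0|right]. Qed.

Lemma ord_geM m k x y :
  ord_ge ord m x -> ord_ge ord k y -> ord_ge ord (m + k) (x * y).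
Proof.
have [->|x0] := eqVneq x 0; first by rewrite mul0r => _ _; left.
have [->|y0] := eqVneq y 0; first by rewrite mulr0 => _ _; left.
rewrite !ord_geE ?mulf_neq0// (lf_ordM hK x0 y0).
exact: lerD.
Qed.

Lemma ord_geD m x y : ord_ge ord m x -> ord_ge ord m y -> ord_ge ord m (x + y).
Proof.
have [->|x0] := eqVneq x 0; first by rewrite add0r.
have [->|y0] := eqVneq y 0; first by rewrite addr0.
have [->|xy0] := eqVneq (x + y) 0; first by left.
rewrite !ord_geE// => hx hy.
by apply: le_trans (lf_ordD hK x0 y0 xy0); rewrite le_min hx hy.
Qed.

Lemma ord_geN m x : ord_ge ord m x -> ord_ge ord m (- x).
Proof.
move=> hx; rewrite -mulN1r -[m]add0r; apply: ord_geM => //.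
by right; rewrite ordN1.
Qed.

Lemma ord_geB m x y : ord_ge ord m x -> ord_ge ord m y -> ord_ge ord m (x - y).
Proof. by move=> hx hy; apply: ord_geD => //; exact: ord_geN. Qed.

Lemma ord_ge_sum m (I : finType) (F : I -> K) :
  (forall i, ord_ge ord m (F i)) -> ord_ge ord m (\sum_i F i).
Proof. by move=> hF; elim/big_ind: _ => //; [left|exact: ord_geD]. Qed.

Lemma ord_geMl a m x :
  a != 0 -> ord_ge ord (ord a + m) (a * x) <-> ord_ge ord m x.
Proof.
move=> a0; have [->|x0] := eqVneq x 0; first by rewrite mulr0; split; left.
by rewrite !ord_geE ?mulf_neq0// (lf_ordM hK a0 x0) lerD2l.
Qed.

Variables (pi : K) (hpi : uniformizer ord pi).

Lemma pi_neq0 : pi != 0. Proof. by case: hpi. Qed.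

Lemma pi_exp_neq0 z : pi ^ z != 0. Proof. exact: expfz_neq0 pi_neq0. Qed.

Lemma ord_pi_exp z : ord (pi ^ z) = z.
Proof.
have nat_case (m : nat) : ord (pi ^ m%:Z) = m%:Z.
  elim: m => [|m IH]; first by rewrite expr0z ord1.
  rewrite intS expfzDr ?pi_neq0// expr1z (lf_ordM hK) ?pi_neq0 ?pi_exp_neq0//.
  by rewrite IH; case: hpi => _ ->.
have [m|m] := lerP 0 z; first by case: z m.
have := lf_ordM hK (pi_exp_neq0 z) (pi_exp_neq0 (- z)).
rewrite -expfzDr ?pi_neq0// subrr expr0z ord1.
have -> : - z = (`|z|%N)%:Z by lia.
rewrite nat_case; lia.
Qed.

Lemma ord_ge_pi_exp m z : ord_ge ord m (pi ^ z) <-> m <= z.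
Proof. by rewrite ord_geE ?pi_exp_neq0// ord_pi_exp. Qed.

Lemma ord_ge_pi_expM z m x : ord_ge ord (z + m) (pi ^ z * x) <-> ord_ge ord m x.
Proof. by rewrite -{1}[z]ord_pi_exp ord_geMl ?pi_exp_neq0. Qed.

Lemma pi_valringE x : pi_valring ord pi x <-> ord_ge ord 1 x.
Proof.
split=> [[y hy <-]|hx].
  by rewrite -[pi]expr1z -[1%R : int]addr0 ord_ge_pi_expM.
exists (pi ^-1 * x); last by rewrite mulVKf ?pi_neq0.
rewrite /= /valring -(ord_ge_pi_expM 1) expr1z mulVKf ?pi_neq0//.
Qed.

(** The expansion with digits in {0, 1}, least significant digit first. *)
Definition pi_adic (s : seq bool) : K := foldr (fun (b : bool) x => b%:R + pi * x) 0 s.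

Lemma pi_adic_integral s : ord_ge ord 0 (pi_adic s).
Proof.
elim: s => [|b s IH] /=; first exact: ord_ge0.
apply: ord_geD; first by case: b; [right; rewrite ord1|left].
by apply: (@ord_geW 1) => //; apply/pi_valringE; exists (pi_adic s).
Qed.

(** The digits 0 and 1 are incongruent modulo pi, so a congruence modulo pi
identifies the first digits; it can then be divided by pi. *)
Lemma pi_adic_inj s s' : size s = size s' ->
  ord_ge ord (size s)%:Z (pi_adic s - pi_adic s') -> s = s'.
Proof.
elim: s s' => [|b s IH] [|b' s'] //= [ss'].
have -> : b%:R + pi * pi_adic s - (b'%:R + pi * pi_adic s') =
   b%:R - b'%:R + pi * (pi_adic s - pi_adic s') by ring.
set D := pi_adic s - _ => h.
have hD : ord_ge ord 0 D by apply: ord_geB; exact: pi_adic_integral.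
have h1 : ord_ge ord 1 (b%:R - b'%:R).
  rewrite -[_ - _](addrK (pi * D)); apply: ord_geB.
    by apply: ord_geW h; lia.
  by apply/pi_valringE; exists D.
have bb' : b = b'.
  move: h1; case: (b) (b') => [] [] //; rewrite ?subr0 ?sub0r => /ord_geE.
    by rewrite oner_neq0 ord1 => /(_ isT).
  by rewrite oppr_eq0 oner_neq0 ordN1 => /(_ isT).
move: h; rewrite bb' subrr add0r -{1}[pi]expr1z intS ord_ge_pi_expM.
by move=> /(IH _ ss') ->.
Qed.

End Valuation.

(** * Symplectic coordinates *)

Section Symplectic.
Variables (n : nat) (K : fieldType) (V : vectType K) (B : {biscalar V}).
Hypothesis hBalt : alternating_form B.

Lemma alternating_skew v w : B v w = - B w v.
Proof.
have := hBalt (v + w); rewrite linearDl /= !linearD /= !hBalt add0r addr0.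
by move/eqP; rewrite addr_eq0 => /eqP.
Qed.

Variables (u w : n.-tuple V).

Section Coordinates.
Hypothesis huw : symplectic_basis B u w.

Lemma symplectic_coord_u (c d : 'I_n -> K) i :
  B (\sum_j c j *: tnth u j + \sum_j d j *: tnth w j) (tnth w i) = c i.
Proof.
case: huw => _ Buw Buu Bww; rewrite linearDl /= !linear_sumlz /=.
rewrite (bigD1 i)//= big1 ?addr0 => [|j /negPf ji].
  rewrite linearZl_LR /= Buw eqxx mulr1 big1 ?addr0// => j _.
  by rewrite linearZl_LR /= Bww mulr0.
by rewrite linearZl_LR /= Buw ji mulr0.
Qed.

Lemma symplectic_coord_w (c d : 'I_n -> K) i :
  B (tnth u i) (\sum_j c j *: tnth u j + \sum_j d j *: tnth w j) = d i.
Proof.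
case: huw => _ Buw Buu Bww; rewrite linearD /= !linear_sum /=.
rewrite big1 ?add0r => [|j _]; last by rewrite linearZ /= Buu mulr0.
rewrite (bigD1 i)//= big1 ?addr0 => [|j ji].
  by rewrite linearZ /= Buw eqxx mulr1.
by rewrite linearZ /= Buw eq_sym (negPf ji) mulr0.
Qed.

Lemma symplectic_expansion v :
  v = \sum_i B v (tnth w i) *: tnth u i + \sum_i B (tnth u i) v *: tnth w i.
Proof.
have [/andP[/eqP sp _] _ _ _] := huw.
have : v \in <<u ++ w>>%VS by rewrite sp memvf.
rewrite span_cat => /memv_addP[x /coord_span hx [y /coord_span hy hv]].
pose c i := coord u i x; pose d i := coord w i y.
have {}hv : v = \sum_i c i *: tnth u i + \sum_i d i *: tnth w i.
  rewrite hv hx hy; congr (_ + _); apply: eq_bigr => i _;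
  by rewrite (tnth_nth 0).
rewrite {1}hv; congr (_ + _); apply: eq_bigr => i _.
  by rewrite hv symplectic_coord_u.
by rewrite hv symplectic_coord_w.
Qed.

Lemma symplectic_form v v' :
  B v v' = \sum_i B v (tnth w i) * B (tnth u i) v'
           - \sum_i B (tnth u i) v * B v' (tnth w i).
Proof.
rewrite {1}[v]symplectic_expansion linearDl /= !linear_sumlz /= -sumrN.
congr (_ + _); apply: eq_bigr => i _; rewrite linearZl_LR //=.
by rewrite [B (tnth w i) _]alternating_skew mulrN.
Qed.

(** The maps u_i |-> a_i u_i + b_i w_i and w_i |-> a_i^-1 w_i generate, in each
hyperbolic plane, the Borel subgroup of SL_2 that stabilises the line of w_i. The
tree argument needs its unipotent part, the normalisation of lattices its
diagonal part. *)
Definition shear (a : 'I_n -> K) (b : 'I_n -> K) : n.-tuple V :=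
  [tuple a i *: tnth u i + b i *: tnth w i | i < n].

Definition scale_inv (a : 'I_n -> K) : n.-tuple V :=
  [tuple (a i)^-1 *: tnth w i | i < n].

Lemma symplectic_shear a b : (forall i, a i != 0) ->
  symplectic_basis B (shear a b) (scale_inv a).
Proof.
move=> a0; have [/andP[/eqP sp fr] Buw Buu Bww] := huw.
have wB i : tnth w i \in <<shear a b ++ scale_inv a>>%VS.
  rewrite -[tnth w i](scalerKV (a0 i)) memvZ// memv_span// mem_cat.
  by apply/orP; right; apply/tnthP; exists i; rewrite tnth_mktuple.
have uB i : tnth u i \in <<shear a b ++ scale_inv a>>%VS.
  rewrite -[tnth u i](scalerK (a0 i)) memvZ//.
  rewrite -[a i *: _](addrK (b i *: tnth w i)) memvB ?memvZ//.
  rewrite memv_span// mem_cat.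
  by apply/orP; left; apply/tnthP; exists i; rewrite tnth_mktuple.
split.
- rewrite basisEdim -sp size_cat !size_tuple; apply/andP; split.
    apply/span_subvP => x; rewrite mem_cat => /orP[] /tnthP[i ->] //.
  by move: fr; rewrite /free size_cat !size_tuple => /eqP ->.
- move=> i j; rewrite !tnth_mktuple linearDl /= !linearZl_LR /= !linearZ /=.
  rewrite Buw Bww !mulr0 addr0; case: eqP => [->|_]; last by rewrite !mulr0.
  by rewrite mulr1 divff.
- move=> i j; rewrite !tnth_mktuple linearDl /= !linearZl_LR /= !linearD /=.
  rewrite !linearZ /= Buu Bww Buw [B (tnth w i) _]alternating_skew Buw eq_sym.
  by case: eqP => [->|_] /=; ring.
- by move=> i j; rewrite !tnth_mktuple linearZl_LR /= linearZ /= Bww !mulr0.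
Qed.

End Coordinates.
End Symplectic.

(** * Lattices in a symplectic frame *)

Lemma even_or_odd (m : int) : exists r, m = r + r \/ m = r + r + 1.
Proof. by exists (m %/ 2)%Z; lia. Qed.

Section Frames.
Variables (n : nat) (K : fieldType) (ord : K -> int) (hK : local_field ord).
Variables (pi : K) (hpi : uniformizer ord pi).
Variables (V : vectType K) (B : {biscalar V}) (hBalt : alternating_form B).

Local Notation frame := (frame_lattice ord pi).
Local Notation ord_ge := (ord_ge ord).
Local Notation pi_exp_neq0 := (pi_exp_neq0 hpi).

(** The coordinates of v are its pairings with the basis vectors, so membership
in a frame lattice is a list of inequalities on the values of the form. *)
Lemma frame_latticeP (u w : n.-tuple V) a b v : symplectic_basis B u w ->
  frame u w a b v <->
  forall i, ord_ge (a i) (B v (tnth w i)) /\ ord_ge (b i) (B (tnth u i) v).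
Proof.
move=> huw; split=> [[c [d [hc hd ->]]] i|h].
  have coef z x : valring ord x -> ord_ge z (x * pi ^ z).
    by rewrite mulrC -{1}[z]addr0 (ord_ge_pi_expM hK hpi).
  by rewrite (symplectic_coord_u huw) (symplectic_coord_w huw); split; exact: coef.
exists (fun i => pi ^ (- a i) * B v (tnth w i)).
exists (fun i => pi ^ (- b i) * B (tnth u i) v).
have coefK z x : pi ^ (- z) * x * pi ^ z = x :> K.
  by rewrite -invr_expz mulrAC mulVf ?mul1r ?pi_exp_neq0.
split=> [i|i|].
- by have [h1 _] := h i; rewrite /valring -(addNr (a i)) (ord_ge_pi_expM hK hpi).
- by have [_ h1] := h i; rewrite /valring -(addNr (b i)) (ord_ge_pi_expM hK hpi).
rewrite {1}(symplectic_expansion huw v).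
by congr (_ + _); apply: eq_bigr => i _; rewrite coefK.
Qed.

Lemma frame_lattice_lattice (u w : n.-tuple V) a b :
  symplectic_basis B u w -> lattice n ord (frame u w a b).
Proof.
move=> huw; have e2n : (n + n = 2 * n)%N by lia.
pose e k := match fintype.split (cast_ord (esym e2n) k) with
  | inl i => pi ^ a i *: tnth u i | inr i => pi ^ b i *: tnth w i end.
pose lo i := cast_ord e2n (lshift n i); pose hi i := cast_ord e2n (rshift n i).
have e_lo i : e (lo i) = pi ^ a i *: tnth u i.
  by rewrite /e cast_ordK (unsplitK (inl i)).
have e_hi i : e (hi i) = pi ^ b i *: tnth w i.
  by rewrite /e cast_ordK (unsplitK (inr i)).
have sumE (c : 'I_(2 * n) -> K) : \sum_k c k *: e k =
    \sum_i (c (lo i) * pi ^ a i) *: tnth u i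
    + \sum_i (c (hi i) * pi ^ b i) *: tnth w i.
  rewrite (reindex (cast_ord e2n)) /=; last first.
    by exists (cast_ord (esym e2n)) => k _; rewrite ?cast_ordK ?cast_ordKV.
  rewrite big_split_ord /=; congr (_ + _); apply: eq_bigr => i _.
    by rewrite -/(lo i) e_lo scalerA.
  by rewrite -/(hi i) e_hi scalerA.
have lohi (P : 'I_(2 * n) -> Prop) :
    (forall i, P (lo i)) -> (forall i, P (hi i)) -> forall k, P k.
  move=> Plo Phi k; rewrite -(cast_ordKV e2n k).
  by case: (fintype.split_ordP (cast_ord (esym e2n) k)) => i ->;
    [exact: Plo|exact: Phi].
exists e; split=> [c _ c0|].
  rewrite sumE in c0; apply: lohi => i.
    have := symplectic_coord_u huw (fun i => c (lo i) * pi ^ a i)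
                               (fun i => c (hi i) * pi ^ b i) i.
    rewrite c0 linear0l => /esym/eqP.
    by rewrite mulf_eq0 (negPf (pi_exp_neq0 _)) orbF => /eqP.
  have := symplectic_coord_w huw (fun i => c (lo i) * pi ^ a i)
                               (fun i => c (hi i) * pi ^ b i) i.
  rewrite c0 linear0 => /esym/eqP.
  by rewrite mulf_eq0 (negPf (pi_exp_neq0 _)) orbF => /eqP.
apply/seteqP; split=> v.
  move=> [c [d [hc hd ->]]].
  pose cd k := match fintype.split (cast_ord (esym e2n) k) with
    | inl i => c i | inr i => d i end.
  have cd_lo i : cd (lo i) = c i by rewrite /cd cast_ordK (unsplitK (inl i)).
  have cd_hi i : cd (hi i) = d i by rewrite /cd cast_ordK (unsplitK (inr i)).
  exists cd; split; first by apply: lohi => i; rewrite ?cd_lo ?cd_hi.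
  by rewrite sumE; congr (_ + _); apply: eq_bigr => i _; rewrite ?cd_lo ?cd_hi.
move=> [c [hc ->]]; rewrite sumE.
by exists (fun i => c (lo i)), (fun i => c (hi i)).
Qed.

Lemma homothety_class_dilate (a : K) (L : set V) : a != 0 ->
  homothety_class (dilate a L) = homothety_class L.
Proof.
have dilateM x y (M : set V) : dilate x (dilate y M) = dilate (x * y) M.
  apply/seteqP; split=> v.
    by move=> [_ [z Mz <-] <-]; exists z; rewrite ?scalerA.
  by move=> [z Mz <-]; exists (y *: z); [exists z|rewrite scalerA].
move=> a0; apply/seteqP; split=> M [x /= x0 <-].
  by exists (x * a); rewrite /= ?mulf_neq0 ?dilateM.
exists (x / a); first by rewrite /= mulf_neq0 ?invr_eq0.
by rewrite dilateM divfK.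
Qed.

Lemma homothety_class_refl (L : set V) : homothety_class L L.
Proof.
exists 1; first by rewrite /= oner_neq0.
apply/seteqP; split=> v; first by move=> [z Lz <-]; rewrite scale1r.
by move=> Lv; exists v; rewrite ?scale1r.
Qed.

Lemma homothety_classP (L M : set V) : homothety_class L = homothety_class M ->
  exists2 a, a != 0 & dilate a L = M.
Proof. by move=> e; have := homothety_class_refl M; rewrite -e => -[a]; exists a. Qed.

Section OneFrame.
Variables (u w : n.-tuple V) (huw : symplectic_basis B u w).

(** Up to homothety only d - c matters, and the parity of d - c is the type of
the special vertex: primitive lattices for even values. *)
Definition balanced (c d : int) : set V := frame u w (fun=> c) (fun=> d).

Lemma balancedP c d v : balanced c d v <->
  forall i, ord_ge c (B v (tnth w i)) /\ ord_ge d (B (tnth u i) v).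
Proof. exact: frame_latticeP. Qed.

Lemma balanced_dilate a c d : a != 0 ->
  dilate a (balanced c d) = balanced (ord a + c) (ord a + d).
Proof.
move=> a0; apply/seteqP; split=> v.
  move=> [z /balancedP hz <-]; apply/balancedP => i.
  by rewrite linearZl_LR linearZ /= !(ord_geMl hK).
move=> /balancedP hv; exists (a^-1 *: v); last by rewrite scalerA divff// scale1r.
apply/balancedP => i; have [h1 h2] := hv i; rewrite linearZl_LR linearZ /=.
by split; apply/(ord_geMl hK _ _ a0); rewrite mulVKf.
Qed.

Lemma balanced_dilate_pi c d :
  dilate pi (balanced c d) = balanced (1 + c) (1 + d).
Proof. by case: hpi => pi0 <-; exact: balanced_dilate. Qed.

Lemma balanced_in_class c d m : d - c = m ->
  homothety_class (balanced 0 m) (balanced c d).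
Proof.
move=> <-; exists (pi ^ c); first exact: pi_exp_neq0.
by rewrite balanced_dilate ?pi_exp_neq0// (ord_pi_exp hK hpi) addr0 addrC subrK.
Qed.

Lemma balanced_u c d i : balanced c d (pi ^ c *: tnth u i).
Proof.
have [_ Buw Buu _] := huw; apply/balancedP => j.
rewrite linearZl_LR linearZ /= Buu Buw mulr0; split; last exact: ord_ge0.
rewrite -[X in ord_ge X]addr0 (ord_ge_pi_expM hK hpi).
by case: eqP => _; [right; rewrite (ord1 hK)|left].
Qed.

Lemma balanced_w c d i : balanced c d (pi ^ d *: tnth w i).
Proof.
have [_ Buw _ Bww] := huw; apply/balancedP => j.
rewrite linearZl_LR linearZ /= Bww Buw mulr0; split; first exact: ord_ge0.
rewrite -[X in ord_ge X]addr0 (ord_ge_pi_expM hK hpi).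
by case: eqP => _; [right; rewrite (ord1 hK)|left].
Qed.

Lemma balanced_sub c d c' d' : c' <= c -> d' <= d ->
  balanced c d `<=` balanced c' d'.
Proof.
move=> cc' dd' v /balancedP hv; apply/balancedP => i.
by have [h1 h2] := hv i; split; [exact: ord_geW h1|exact: ord_geW h2].
Qed.

Lemma balanced_form c d m : m <= c + d ->
  form_in B (ord_ge m) (balanced c d).
Proof.
move=> hm v v' /balancedP hv /balancedP hv'; rewrite (symplectic_form hBalt huw).
apply: ord_geB => //; apply: ord_ge_sum => // i.
  by apply: ord_geW hm _; apply: ord_geM => //; [case: (hv i)|case: (hv' i)].
rewrite addrC in hm; apply: ord_geW hm _.
by apply: ord_geM => //; [case: (hv i)|case: (hv' i)].
Qed.

Lemma balanced_form_pi c d : 1 <= c + d ->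
  form_in B (pi_valring ord pi) (balanced c d).
Proof.
by move=> /balanced_form h v v' hv hv'; apply/(pi_valringE hK hpi); exact: h.
Qed.

Lemma balanced_primitive r : primitive n ord pi B (balanced (- r) r).
Proof.
split; first exact: frame_lattice_lattice.
  by apply: balanced_form; rewrite addNr.
move=> v _ hv; rewrite balanced_dilate_pi; apply/balancedP => i.
(* Testing against pi^-r u_i and pi^r w_i reads off the coordinates of v. *)
have := hv _ (balanced_w (- r) r i); have := hv _ (balanced_u (- r) r i).
rewrite !linearZ /= !(pi_valringE hK hpi).
rewrite -[X in ord_ge X (_ ^ (- r) * _)](addKr r) [r + 1]addrC.
rewrite -[X in ord_ge X (_ ^ r * _)](addNKr r) [- r + 1]addrC.
rewrite !(ord_ge_pi_expM hK hpi) => h1 h2; split=> //.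
by rewrite (alternating_skew hBalt); exact: ord_geN.
Qed.

Lemma special_balanced m :
  special_vertex n ord pi B (homothety_class (balanced 0 m)).
Proof.
split; last first.
  exists (balanced 0 m), u, w, (fun=> 0), (fun=> m); split=> //.
  exact: homothety_class_refl.
split; first by exists (balanced 0 m) => //; exact: frame_lattice_lattice.
have [r [->|->]] := even_or_odd m.
  (* The representative is pi L0 itself; for odd m its image in L0 / pi L0 is
     Lagrangian. *)
  exists (balanced (1 - r) (1 + r)), (balanced (- r) r).
  rewrite balanced_dilate_pi; split.
  - by apply: balanced_in_class; lia.
  - exact: balanced_primitive.
  - by apply: balanced_form_pi; lia.
  - exact: subset_refl.
  - by apply: balanced_sub; lia.
exists (balanced (- r) (1 + r)), (balanced (- r) r).
rewrite balanced_dilate_pi; split.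
- by apply: balanced_in_class; lia.
- exact: balanced_primitive.
- by apply: balanced_form_pi; lia.
- by apply: balanced_sub; lia.
- by apply: balanced_sub; lia.
Qed.

(** Of two consecutive vertices one is the class of a primitive lattice L0 and
the other one that of a lattice L with pi L0 < L < L0 whose image in L0 / pi L0
is Lagrangian, spanned by multiples of the u_i when m is even and of the w_i
when m is odd. *)
Lemma balanced_incident m :
  incident n ord pi B (homothety_class (balanced 0 m))
                      (homothety_class (balanced 0 (m + 1))).
Proof.
have [r [->|->]] := even_or_odd m.
  exists (balanced (1 - r) (1 + r)), (balanced (- r) (1 + r)), (balanced (- r) r).
  rewrite balanced_dilate_pi; split.
  - by split; apply: balanced_in_class; lia.
  - exact: balanced_primitive.
  - by apply: balanced_form_pi; lia.
  - by apply: balanced_form_pi; lia.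
  - by left; split; apply: balanced_sub; lia.
exists (balanced (- r) (1 + r)), (balanced (- r) (1 + (1 + r))).
exists (balanced (- (1 + r)) (1 + r)).
rewrite balanced_dilate_pi; split.
- by split; apply: balanced_in_class; lia.
- exact: balanced_primitive.
- by apply: balanced_form_pi; lia.
- by apply: balanced_form_pi; lia.
- by right; split; apply: balanced_sub; lia.
Qed.

End OneFrame.

(** * The tree of rays from a special vertex *)

(** A homothety between two such lattices is by a unit, hence an equality of
lattices; with u' = u this separates the levels m, and with u' a transvection of
u it separates the rays. *)
Lemma balanced_class_inj (u u' w : n.-tuple V) m m' (i : 'I_n) :
    symplectic_basis B u w -> symplectic_basis B u' w ->
    homothety_class (balanced u w 0 m) = homothety_class (balanced u' w 0 m') ->
  m = m' /\ ord_ge m' (B (tnth u' i) (tnth u i)).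
Proof.
move=> huw huw' /homothety_classP[x x0]; rewrite balanced_dilate// => e.
have [_ Buw _ _] := huw; have [_ Buw' _ _] := huw'.
have tu := balanced_u huw (ord x + 0) (ord x + m) i.
have tu' := balanced_u huw' 0 m' i.
(* Comparing the coordinates along u of u_i and u'_i makes x a unit. *)
have ox : ord x = 0.
  rewrite e in tu; rewrite -e in tu'.
  have [+ _] := (balancedP huw' _ _ _).1 tu i.
  have [+ _] := (balancedP huw _ _ _).1 tu' i.
  by rewrite !linearZl_LR /= Buw Buw' eqxx !mulr1 !(ord_ge_pi_exp hK hpi); lia.
rewrite ox expr0z scale1r !add0r in e tu; split; last first.
  by rewrite e in tu; have [_] := (balancedP huw' _ _ _).1 tu i.
have tw := balanced_w huw 0 m i; have tw' := balanced_w huw' 0 m' i.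
rewrite e in tw; rewrite -e in tw'.
have [_ +] := (balancedP huw' _ _ _).1 tw i.
have [_ +] := (balancedP huw _ _ _).1 tw' i.
by rewrite !linearZ /= Buw Buw' eqxx !mulr1 !(ord_ge_pi_exp hK hpi); lia.
Qed.

Hypothesis n_gt0 : (0 < n)%N.

Lemma balanced_Y_edge (u w : n.-tuple V) m : symplectic_basis B u w ->
  Y_edge n ord pi B (homothety_class (balanced u w 0 m))
                    (homothety_class (balanced u w 0 (m + 1))).
Proof.
move=> huw; split; [exact: special_balanced..|split; last exact: balanced_incident].
by move=> /(balanced_class_inj (Ordinal n_gt0) huw huw)[]; lia.
Qed.

(** Rescaling u_i by pi^(a_i) and w_i by pi^(-a_i) keeps the basis symplectic
and moves all the exponents to w, where they become the common sum a_i + b_i. *)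
Lemma special_vertexE x : special_vertex n ord pi B x ->
  exists (u w : n.-tuple V) m,
    symplectic_basis B u w /\ x = homothety_class (balanced u w 0 m).
Proof.
move=> [[[L1 _ ->] _] [L [u [w [a [b [[y /= y0 yL] huw Lf ab]]]]]]].
have pa0 i : pi ^ a i != 0 by exact: pi_exp_neq0.
have huw' := symplectic_shear hBalt huw (fun=> 0) pa0.
exists (shear u w (fun i => pi ^ a i) (fun=> 0)), (scale_inv w (fun i => pi ^ a i)).
exists (a (Ordinal n_gt0) + b (Ordinal n_gt0)); split=> //.
rewrite -(homothety_class_dilate L1 y0) yL Lf; congr homothety_class.
apply/seteqP; split=> v.
  move=> /(frame_latticeP _ _ _ huw) hv; apply/(balancedP huw') => i.
  rewrite !tnth_mktuple scale0r addr0 linearZ linearZl_LR /= invr_expz.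
  rewrite (ab _ i) -{1}(addNr (a i)) !(ord_ge_pi_expM hK hpi); exact: hv.
move=> /(balancedP huw') hv; apply/(frame_latticeP _ _ _ huw) => i.
move: (hv i).
rewrite !tnth_mktuple scale0r addr0 linearZ linearZl_LR /= invr_expz.
by rewrite (ab _ i) -{1}(addNr (a i)) !(ord_ge_pi_expM hK hpi).
Qed.

Definition transvection (u w : n.-tuple V) (p : K) : n.-tuple V :=
  shear u w (fun=> 1) (fun=> p).

Lemma symplectic_transvection (u w : n.-tuple V) p :
  symplectic_basis B u w -> symplectic_basis B (transvection u w p) w.
Proof.
move=> huw; rewrite -[in X in _ _ X](_ : scale_inv w (fun=> 1) = w); last first.
  by apply: eq_from_tnth => i; rewrite tnth_mktuple invr1 scale1r.
by apply: symplectic_shear => // i; exact: oner_neq0.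
Qed.

Lemma form_transvection (u w : n.-tuple V) p i v :
  B (tnth (transvection u w p) i) v = B (tnth u i) v - p * B v (tnth w i).
Proof.
rewrite tnth_mktuple scale1r linearDl linearZl_LR /=.
by rewrite [B (tnth w i) v](alternating_skew hBalt) mulrN.
Qed.

(** The transvection is integral on the lattice of level m, hence stabilises
it: all the rays that it produces start at the same vertex. *)
Lemma balanced_transvection (u w : n.-tuple V) p m :
    symplectic_basis B u w -> ord_ge m p ->
  balanced (transvection u w p) w 0 m = balanced u w 0 m.
Proof.
move=> huw hp; have huwp := symplectic_transvection p huw.
have hpv v i : ord_ge 0 (B v (tnth w i)) -> ord_ge m (p * B v (tnth w i)).
  by move=> ?; rewrite -[m]addr0; exact: ord_geM.
apply/seteqP; split=> v.
  move=> /(balancedP huwp) hv; apply/(balancedP huw) => i.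
  have [h1] := hv i; rewrite form_transvection => h2; split=> //.
  by rewrite -(subrK (p * B v (tnth w i)) (B _ v)); apply: ord_geD => //; exact: hpv.
move=> /(balancedP huw) hv; apply/(balancedP huwp) => i.
have [h1 h2] := hv i; rewrite form_transvection; split=> //.
by apply: ord_geB => //; exact: hpv.
Qed.

(** The pairing of u_i + p w_i and u_i + p' w_i is p - p' up to sign. *)
Lemma transvection_class_inj (u w : n.-tuple V) p p' m :
    symplectic_basis B u w ->
    homothety_class (balanced (transvection u w p) w 0 m) =
      homothety_class (balanced (transvection u w p') w 0 m) ->
  ord_ge m (p - p').
Proof.
move=> huw; have huwp := symplectic_transvection p huw.
move=> /(balanced_class_inj (Ordinal n_gt0) huwp (symplectic_transvection p' huw)).
move=> [_]; rewrite form_transvection; have [_ Bpw _ _] := huwp.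
rewrite Bpw eqxx mulr1 (alternating_skew hBalt) form_transvection.
have [_ Buw _ _] := huw.
by rewrite hBalt Buw eqxx mulr1 sub0r opprK.
Qed.

Lemma transvection_in_Y_ball (R : realType) (u w : n.-tuple V) p m i :
    symplectic_basis B u w -> ord_ge m p ->
  Y_ball R n ord pi B i (homothety_class (balanced u w 0 m))
    (homothety_class (balanced (transvection u w p) w 0 (m + i%:Z))).
Proof.
move=> huw hp; have huwp := symplectic_transvection p huw.
split; first exact: special_balanced.
apply: ereal_inf_lbound; exists i => //=.
exists (fun j => homothety_class (balanced (transvection u w p) w 0 (m + j%:Z))).
split=> [||j _] //; first by rewrite addr0 balanced_transvection.
by rewrite intS [1 + _]addrC addrA; exact: balanced_Y_edge.
Qed.

End Frames.

(** * Counting *)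

Lemma counting_lower_bound (R : realType) (T : choiceType) (I : finType)
    (f : I -> T) (A : set T) : injective f -> (forall i, A (f i)) ->
  (#|I|%:R%:E <= counting A :> \bar R)%E.
Proof.
move=> finj fA; rewrite /counting; case: asboolP => [Afin|_]; last exact: leey.
rewrite lee_fin ler_nat cardE -(size_map f); apply: uniq_leq_size.
  by rewrite map_inj_uniq ?enum_uniq.
by move=> _ /mapP[i _ ->]; rewrite in_fset_set ?inE.
Qed.

Theorem corollary2p9 (R : realType) (n : nat) (hn : (2 <= n)%N)
    (K : fieldType) (ord : K -> int) (hK : local_field ord)
    (pi : K) (hpi : uniformizer ord pi)
    (V : vectType K) (hV : \dim {:V} = (2 * n)%N)
    (B : {biscalar V})
    (hBalt : alternating_form B) (hBnd : nondegenerate_form B) :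
  exists C : R, 1 < C /\
    forall x : set (set V), special_vertex n ord pi B x ->
    forall i : nat, (1 <= i)%N ->
      ((C ^+ i)%:E < counting (Y_ball R n ord pi B i x))%E.
Proof.
have n_gt0 : (0 < n)%N by exact: ltnW.
exists (3 / 2); split=> [|x]; first lra.
move=> /(special_vertexE hK hpi hBalt n_gt0)[u [w [m [huw ->]]]] i i1.
pose p (s : i.-tuple bool) := pi ^ m * pi_adic pi s.
pose f s := homothety_class (balanced ord pi (transvection u w (p s)) w 0 (m + i%:Z)).
apply: (@lt_le_trans _ _ (2 ^+ i)%:E).
  by rewrite lte_fin ltrXn2r -?lt0n//; lra.
rewrite -natrX -(card_bool) -card_tuple.
apply: (@counting_lower_bound _ _ _ f) => [s s'|s].
  move=> /(transvection_class_inj hK hpi hBalt n_gt0 huw).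
  rewrite /p -mulrBr (ord_ge_pi_expM hK hpi) => h; apply/val_inj.
  by apply: (pi_adic_inj hK hpi); rewrite !size_tuple.
apply: transvection_in_Y_ball => //.
by rewrite /p -{1}[m]addr0; apply/(ord_ge_pi_expM hK hpi)/(pi_adic_integral hK hpi).
Qed.
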